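(* Let $p \ge 2$ and $\bar p = \{1,\dots,p\}$. Assume that: 1) $f : D = \mathrm{dom}\, f \subset X \to (-\infty,\infty]$ is a lower-semicontinuous, proper, strictly convex and totally convex function which is Gâteaux differentiable in $\mathrm{int}\, D$. 2) $A_i \neq \emptyset$, $A_i \subseteq \mathrm{int}\, D \subset H$ ($i \in \bar p$), are bounded, closed and convex subsets of $H$ with $\bigcap_{i\in\bar p} A_i \ne \emptyset$, and $T : \bigcup_{i\in\bar p} A_i \to \bigcup_{i \in \bar p} A_i$ is a generalized point-dependent $(K,\lambda)$-hybrid $p$-cyclic self-mapping relative to $D_f$, for some function $\lambda : \bigcup_{i \in\bar p} A_i \to \Lambda \subset \mathbb{R}$ with $\Lambda$ bounded, and some $K : \bigcup_{i\in\bar p} A_i \to (0,1)$ defined by $K(y) = \prod_{j=i}^{i+p-1} K_j(T^{j-i} y)$ for any $y \in A_{i+1}$, $i \in \bar p$, for some functions $K_i : A_{i+1} \to (0,a_i]$ with $a_i\in\mathbb{R}_+$, $i \in \bar p$. 3) There is some $x \in \bigcup_{i\in\bar p} A_i$ such that the sequence $\{T^n x\}$ converges to some $z \in \bigcap_{i \in \bar p} A_i$. Then $z = Tz$ is the unique fixed point of $T : \bigcup_{i\in\bar p} A_i \to \bigcup_{i \in\bar p} A_i$, and all sequences $\{T^n x\}$, for any $x \in \bigcup_{i\in\bar p} A_i$, converge to $z$.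
   Context: Setting: $H$ is a Hilbert space with inner product $\langle\cdot,\cdot\rangle$, $(X,\|\cdot\|)$ is the Banach space with $H\subset X$, the norm being induced by the inner product, $\|x\| = \langle x,x\rangle^{1/2}$; $\langle y, x^*\rangle$ also denotes the pairing of $y \in X$ with $x^* \in X^*$. $\mathbb{R}_+$ is the set of positive reals. Convergence of $\{T^n x\} = \{T^n x\}_{n\ge 0}$ is in norm; $T^0$ is the identity. Cyclic mappings: indices of the sets $A_i$ and of the functions $K_i$ are taken modulo $p$ (so $A_{i+p}=A_i$, $K_{i+p} = K_i$). $T$ is $p$-cyclic if $T(A_i)\subseteq A_{i+1}$ for all $i \in \bar p$. Convex functions: $D = \mathrm{dom}\, f = \{x \in X: f(x)<\infty\}$ is nonempty ($f$ proper) and convex. $f$ is strictly convex if $f(\alpha x+(1-\alpha)y) < \alpha f(x)+(1-\alpha)f(y)$ for $x\neq y$ in $D$, $\alpha\in(0,1)$. $f'(x) \in X^*$ is the Gâteaux derivative of $f$ at $x \in \mathrm{int}\, D$: $\lim_{t\to0}\frac{f(x+ty)-f(x)}{t} = \langle y, f'(x)\rangle$. Bregman distance: $D_f(y,x) = f(y)-f(x)-\langle y-x,f'(x)\rangle$ where $f$ is Gâteaux differentiable at $x$; where it is not, $D_f(y,x) = f(y)-f(x)+f^0(x,x-y)$ with $f^0(x,x-y)=\lim_{t\to0^+}\frac{f(x+t(x-y))-f(x)}{t}$. Total convexity: let $D^0$ be the algebraic interior of $D$, i.e. the set of $x \in D$ such that for every $y \in X\setminus\{x\}$ there is $z \in (x,y)$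 with $[x,z]\subseteq D$. The modulus of total convexity is $v_f(x,t) = \inf\{D_f(x,y) : y \in D, \|y-x\|=t\}$ for $x \in D^0$, $t \ge 0$; $f$ is totally convex if $v_f(x,t) > 0$ for $t>0$. Hybrid mappings: the $p$-cyclic self-mapping $T$ is a generalized point-dependent $(K,\lambda)$-hybrid $p$-cyclic self-mapping relative to $D_f$ if $$D_f(Tx,Ty) \le K_i(y) D_f(x,y) + \lambda(y)\langle x-Tx, f'(y)-f'(Ty)\rangle \quad \text{for all } x\in A_i,\ y\in A_{i+1},\ i\in\bar p,$$ for functions $\lambda$, $K_i$ and $K$ as in the claim. *)

(* Defs.v *)
From HB Require Import structures.
From mathcomp Require Import all_boot all_order all_algebra.
From mathcomp Require Import all_classical all_reals all_analysis.

Set Implicit Arguments.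
Unset Strict Implicit.
Unset Printing Implicit Defensive.

Import Order.TTheory GRing.Theory Num.Theory.
Import numFieldNormedType.Exports.

Local Open Scope classical_set_scope.
Local Open Scope ring_scope.

Section HilbertSubspace.
Context {R : realType} {X : completeNormedModType R}.

(* [ip] is only constrained on [H]; its values elsewhere are irrelevant. *)
Record hilbert_subspace (H : set X) (ip : X -> X -> R) : Prop := {
  hilbert_zero : H 0 ;
  hilbert_comb : forall (a : R) x y, H x -> H y -> H (a *: x + y) ;
  ip_sym : forall x y, H x -> H y -> ip x y = ip y x ;
  ip_linear : forall (a : R) x y z, H x -> H y -> H z ->
    ip (a *: x + y) z = a * ip x z + ip y z ;
  ip_pos : forall x, H x -> x != 0 -> 0 < ip x x ;
  ip_norm : forall x, H x -> `|x| = Num.sqrt (ip x x) ;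
  hilbert_complete : forall u : nat -> X, (forall n, H (u n)) ->
    cauchy (u n @[n --> \oo]) ->
    exists2 l, H l & u n @[n --> \oo] --> l
}.

End HilbertSubspace.

Section ConvexFunctions.
Context {R : realType} {X : completeNormedModType R}.
Implicit Types (f : X -> \bar R) (D : set X) (x y z d : X).

Local Open Scope ereal_scope.

Definition dom f : set X := [set x | f x < +oo].

Definition proper_function f := dom f !=set0 /\ forall x, -oo < f x.

Definition strictly_convex f := forall x y (a : R),
  dom f x -> dom f y -> x <> y -> (0 < a < 1)%R ->
  f (a *: x + (1 - a) *: y)%R < a%:E * f x + (1 - a)%:E * f y.

(* [gateaux f x y] is the value at y of f'(x). Only used at interior points of
   the domain, near which a proper f is finite, so that [fine] is harmless. *)
Definition gateaux f x : X -> R := fun y => 'D_y (fine \o f : X -> R^o) x.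

Definition gateaux_differentiable f x :=
  [/\ (dom f)° x,
      forall y, derivable (fine \o f : X -> R^o) x y,
      linear (gateaux f x : X -> R^o) &
      continuous (gateaux f x : X -> R^o)].

(* f^0(x,d); it is +oo when x + t d leaves the domain for all small t > 0. *)
Definition right_derivative f x d : \bar R :=
  lim ((f (x + t *: d)%R - f x) * (t^-1)%:E @[t --> (0 : R)^'+]).

(* D_f(y,x) *)
Definition bregman f y x : \bar R :=
  if `[< gateaux_differentiable f x >]
  then f y - f x - (gateaux f x (y - x)%R)%:E
  else f y - f x + right_derivative f x (x - y)%R.

Definition open_segment x y : set X :=
  [set ((1 - s) *: x + s *: y)%R | s in [set s : R | (0 < s < 1)%R]].

Definition closed_segment x y : set X :=
  [set ((1 - s) *: x + s *: y)%R | s in [set s : R | (0 <= s <= 1)%R]].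

Definition algebraic_interior D : set X :=
  [set x | D x /\ forall y, y <> x ->
    exists2 z, open_segment x y z & closed_segment x z `<=` D].

Definition total_convexity_modulus f x (t : R) : \bar R :=
  ereal_inf [set bregman f x y | y in [set y | dom f y /\ `|y - x|%R = t]].

Definition totally_convex f := forall x (t : R),
  algebraic_interior (dom f) x -> (0 < t)%R ->
  0 < total_convexity_modulus f x t.

End ConvexFunctions.

Section CyclicMaps.
Context {R : realType} {X : completeNormedModType R} {p : nat}.
Implicit Types (f : X -> \bar R) (A : 'I_p -> set X) (T : X -> X).

(* The index set {1,...,p} taken modulo p is 'I_p with the cyclic successor
   [ordS]. T is a map on X whose values off the union of the A_i are ignored. *)
Definition cyclic_map A T := forall i, set_fun (A i) (A (ordS i)) T.

(* The pairing of u in X with f'(y) - f'(Ty). *)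
Definition gateaux_gap f T (y u : X) : R := gateaux f y u - gateaux f (T y) u.

Definition hybrid_inequality f A T (Ki : 'I_p -> X -> R) (lam : X -> R) :=
  forall i x y, A i x -> A (ordS i) y ->
  (bregman f (T x) (T y) <=
    (Ki i y)%:E * bregman f x y + (lam y * gateaux_gap f T y (x - T x))%:E)%E.

(* The product K_i(y) K_(i+1)(T y) ... K_(i+p-1)(T^(p-1) y), for y in A_(i+1). *)
Definition cyclic_product T (Ki : 'I_p -> X -> R) (i : 'I_p) (y : X) : R :=
  \prod_(k < p) Ki (iter k (@ordS p) i) (iter k T y).

(* T is a generalized point-dependent (K,lam)-hybrid p-cyclic self-mapping of
   the union of the A_i relative to D_f, with factors K_i valued in (0,a_i]. *)
Record hybrid_cyclic f A T (K : X -> R) (lam : X -> R)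
    (Ki : 'I_p -> X -> R) (a : 'I_p -> R) : Prop := {
  hybrid_self : set_fun (\bigcup_i A i) (\bigcup_i A i) T ;
  hybrid_cyclic_map : cyclic_map A T ;
  hybrid_bound_gt0 : forall i, 0 < a i ;
  hybrid_factor : forall i y, A (ordS i) y -> 0 < Ki i y <= a i ;
  hybrid_modulus : forall y, (\bigcup_i A i) y -> 0 < K y < 1 ;
  hybrid_product : forall i y, A (ordS i) y -> K y = cyclic_product T Ki i y ;
  hybrid_ineq : hybrid_inequality f A T Ki lam
}.

End CyclicMaps.

(* Main.v *)
Require Import Defs.
From HB Require Import structures.
From mathcomp Require Import all_boot all_order all_algebra.
From mathcomp Require Import all_classical all_reals all_analysis.
From mathcomp Require Import ring lra.

Set Implicit Arguments.
Unset Strict Implicit.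
Unset Printing Implicit Defensive.

Import Order.TTheory GRing.Theory Num.Theory.
Import numFieldNormedType.Exports.

Local Open Scope classical_set_scope.
Local Open Scope ring_scope.

(** Why the theorem holds. Write [D(y, x)] for the Bregman distance, which is
a nonnegative real vanishing only at [y = x] as long as both points are
interior to the domain of [f].

- The limit is fixed. Apply the hybrid inequality to [x = T^n x0] and [y = z].
  As [n] grows, the factors [K_i(z)] stay below the sum of the [a_i],
  [D(T^n x0, z)] tends to [D(z, z) = 0], and the gradient term tends to [0]
  because consecutive iterates approach each other. Hence [D(z, Tz) <= 0] and
  [Tz = z] ([limit_fixed]). Passing to the limit in [D(., x)] needs the
  norm continuity of [f] at interior points; for a convex lower semicontinuous
  function on a Banach space this follows from Baire's theorem
  ([bounded_above_near], [convex_lsc_continuous]).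

- All orbits converge. Once [z] is fixed the gradient term at [y = z] is zero,
  and going once around the cycle multiplies [D(., z)] by at most [K(z) < 1].
  So [D(T^n x, z)] decays geometrically along every orbit ([orbit_cvg]), and
  uniqueness follows since the constant orbit of a fixed point tends to [z].

- Bregman convergence implies norm convergence ([cvg_real_bregman0]). The
  modulus of total convexity at [x] bounds [D(x, m)] from below, with the base
  point [m] moving, whereas [D(y, x)] with [x] fixed is what is controlled.
  The two are compared through a point [m] of the segment from [x] to [y], in
  the half nearer to [x]: the slope of [f] there already accounts for [D(x, m)],
  and by convexity [f] keeps at least that slope from [m] to [y], which gives
  [D(x, m) <= D(y, x)] ([real_bregman_split], [real_bregman_ge_far]). *)

(** * Continuity of convex lower semicontinuous functions *)

Lemma cvg_dilation {R : realType} {X : normedModType R} (x y : X) (c : R) :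
  y + c *: (w - x) @[w --> x] --> y.
Proof.
suff : y + c *: (w - x) @[w --> x] --> y + c *: (x - x).
  by rewrite subrr scaler0 addr0.
apply: cvgD; first exact: cvg_cst.
by apply: cvgZl_tmp; apply: cvgB; [exact: cvg_id|exact: cvg_cst].
Qed.

Section ConvexContinuity.
Context {R : realType} {X : completeNormedModType R} {f : X -> \bar R}.
Context (f_proper : proper_function f) (f_strict : strictly_convex f).

Lemma dom_fineK x : dom f x -> (fine (f x))%:E = f x.
Proof.
move=> fx; rewrite fineK// fin_numElt fx andbT.
by case: f_proper => _ /(_ x).
Qed.

Lemma convex_ereal x y (s : R) : dom f x -> dom f y -> 0 <= s <= 1 ->
  (f (s *: x + (1 - s) *: y)%R <= s%:E * f x + (1 - s)%:E * f y)%E.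
Proof.
move=> fx fy /andP[s0 s1].
have [->|/eqP xy] := eqVneq x y.
  by rewrite -scalerDl subrKC scale1r -(dom_fineK fy) -!EFinM -EFinD -mulrDl subrKC mul1r.
have [->|sn0] := eqVneq s 0.
  by rewrite scale0r subr0 scale1r add0r mul0e mul1e add0e.
have [->|sn1] := eqVneq s 1.
  by rewrite subrr scale0r scale1r addr0 mul0e mul1e adde0.
by apply/ltW/f_strict => //; rewrite !lt_neqAle eq_sym sn0 s0 sn1.
Qed.

Lemma convex_fine x y (s : R) : dom f x -> dom f y -> 0 <= s <= 1 ->
  dom f (s *: x + (1 - s) *: y) /\
  fine (f (s *: x + (1 - s) *: y)) <= s * fine (f x) + (1 - s) * fine (f y).
Proof.
move=> fx fy s01; have le_f := convex_ereal fx fy s01.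
rewrite -(dom_fineK fx) -(dom_fineK fy) -!EFinM -EFinD in le_f.
have fs : dom f (s *: x + (1 - s) *: y) by rewrite /dom/= (le_lt_trans le_f)// ltry.
by split=> //; rewrite -lee_fin dom_fineK//.
Qed.

(** The sets of [u] with [f (x + u) <= k] and [f (x - u) <= k] are closed,
convex and symmetric, and their union over [k] contains a ball around [0]. By
Baire's theorem one of them contains an open set, and being convex and
symmetric it then contains a neighbourhood of [0]. *)
Lemma bounded_above_near x : lower_semicontinuous f -> (dom f)° x ->
  exists M : R, \forall y \near x, (f y <= M%:E)%E.
Proof.
move=> /lower_semicontinuousP f_open /nbhs_ballP[r /= r0 ball_dom].
(* [G k] is the complement of the [k]-th of these sets. *)
pose G k := [set u : X | (k%:R%:E < f (x + u)%R)%E] `|`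
            [set u : X | (k%:R%:E < f (x - u)%R)%E].
have G_open k : open (G k).
  apply: openU.
    apply: (@open_comp _ _ (fun u => x + u)) (f_open k%:R) => u _.
    by apply: cvgD; [exact: cvg_cst|exact: cvg_id].
  apply: (@open_comp _ _ (fun u => x - u)) (f_open k%:R) => u _.
  by apply: cvgB; [exact: cvg_cst|exact: cvg_id].
have [k Gk] : exists k, ~ dense (G k).
  apply/existsNP => G_dense.
  have /(_ (ball 0 r)) := Baire (fun k => conj (G_open k) (G_dense k)).
  case; [by exists 0; exact: ballxx|exact: ball_open|].
  move=> u [u_r G_u].
  have fD : dom f (x + u).
    apply: ball_dom; move: u_r; rewrite -!ball_normE/=.
    by rewrite sub0r normrN opprD addrA subrr sub0r normrN.
  have fB : dom f (x - u).
    apply: ball_dom; move: u_r; rewrite -!ball_normE/=.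
    by rewrite sub0r normrN opprB addrC subrK.
  pose m := Num.max (fine (f (x + u))) (fine (f (x - u))).
  have := G_u (Num.trunc m).+1 I.
  have m_lt := truncnS_gt m.
  rewrite /G/= -(dom_fineK fD) -(dom_fineK fB) !lte_fin.
  by case=> /(lt_trans m_lt); rewrite ltNge /m le_max lexx ?orbT.
exists k%:R.
have [W [[y Wy] W_open WG]] : exists W : set X,
    [/\ W !=set0, open W & W `&` G k = set0].
  move: Gk => /existsNP[W /not_implyP[W0 /not_implyP[oW /set0P/negP]]].
  by rewrite negbK => /eqP; exists W.
have W_le u : W u -> (f (x + u)%R <= k%:R%:E)%E /\ (f (x - u)%R <= k%:R%:E)%E.
  move=> Wu; have nG : ~ G k u.
    by move=> Gu; have : (W `&` G k) u by []; rewrite WG.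
  by split; rewrite leNgt; apply/negP => lt_f; apply: nG; [left|right].
have near_W (c : R) : \forall w \near x, W (y + c *: (w - x)).
  exact: (@cvg_dilation _ _ x y c _ (open_nbhs_nbhs (conj W_open Wy))).
(* [w] is the midpoint of [x + u] and [x - u'], with [u = y + (w - x)] and
   [u' = y - (w - x)] both in [W] for [w] close to [x]. *)
near=> w.
have fp : (f (x + (y + 1 *: (w - x)))%R <= k%:R%:E)%E.
  by apply: (proj1 (W_le _ _)); near: w; exact: (near_W 1).
have fm : (f (x - (y + -1 *: (w - x)))%R <= k%:R%:E)%E.
  by apply: (proj2 (W_le _ _)); near: w; exact: (near_W (-1)).
have half01 : 0 <= (2^-1 : R) <= 1 by lra.
have := convex_ereal (le_lt_trans fp (ltry _)) (le_lt_trans fm (ltry _)) half01.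
have -> : 2^-1 *: (x + (y + 1 *: (w - x))) +
   (1 - 2^-1) *: (x - (y + -1 *: (w - x))) = w.
  have -> : (1 - 2^-1 : R) = 2^-1 by lra.
  rewrite -scalerDr scale1r scaleN1r; set v := w - x.
  have -> : w = x + v by rewrite subrKC.
  rewrite opprB addrACA (addrC y) (addrACA v) subrr addr0 addrACA -mulr2n -[(x + v) *+ 2]scaler_nat.
  by rewrite scalerA mulVf ?scale1r// pnatr_eq0.
move=> /le_trans; apply.
have -> : (k%:R%:E = (2^-1 : R)%:E * k%:R%:E + (1 - 2^-1 : R)%:E * k%:R%:E)%E.
  by rewrite -!EFinM -EFinD -mulrDl subrKC mul1r.
by apply: leeD; rewrite lee_pmul2l ?lte_fin//; lra.
Unshelve. all: by end_near.
Qed.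

(** Lower semicontinuity is one half of continuity. For the other, a bound
[f <= M] near [x] improves to [f y <= f x + s * (M - f x)] for [y] in the
neighbourhood shrunk by the factor [s], since [y] divides the segment from [x]
to the dilated point [x + (y - x) / s] in the ratio [s]. *)
Lemma convex_lsc_continuous x : lower_semicontinuous f -> (dom f)° x ->
  fine (f y) @[y --> x] --> fine (f x).
Proof.
move=> f_lsc x_int.
have [M0 nearM0] := bounded_above_near f_lsc x_int.
have fx : dom f x by exact: interior_subset x_int.
pose M := Num.max M0 (fine (f x)).
have M_ge : fine (f x) <= M by rewrite le_max lexx orbT.
apply/cvgrPdist_le => e e0.
(* The summand 1 keeps the denominator positive when [M] is the value at [x]. *)
pose s := Num.min 1 (e / (M - fine (f x) + 1)).
have s0 : 0 < s by rewrite lt_min ltr01 divr_gt0//; lra.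
have s1 : s <= 1 by rewrite ge_min lexx.
have s_small : s * (M - fine (f x)) <= e.
  have sB : s <= e / (M - fine (f x) + 1) by rewrite ge_min lexx orbT.
  have B0 : 0 < M - fine (f x) + 1 by lra.
  move: sB; rewrite ler_pdivlMr// => sB.
  by apply: le_trans sB; rewrite ler_pM2l//; lra.
have near_w : \forall y \near x, (f (x + s^-1 *: (y - x))%R <= M%:E)%E.
  apply: (@cvg_dilation _ _ x x s^-1 [set u | (f u <= M%:E)%E]).
  apply: filterS nearM0 => y /le_trans; apply.
  by rewrite lee_fin le_max lexx.
have near_lsc : \forall y \near x, ((fine (f x) - e)%:E < f y)%E.
  have [|V xV V_lt] := f_lsc x (fine (f x) - e); last exact: filterS xV.
  by rewrite -(dom_fineK fx) lte_fin/=; lra.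
near=> y.
have fy : dom f y by near: y.
have lower : fine (f x) - e < fine (f y).
  by rewrite -lte_fin dom_fineK//; near: y.
have fw : (f (x + s^-1 *: (y - x))%R <= M%:E)%E by near: y.
have dom_w := le_lt_trans fw (ltry M).
have [|_] := convex_fine (s := s) dom_w fx; first by rewrite ltW.
have -> : s *: (x + s^-1 *: (y - x)) + (1 - s) *: x = y.
  rewrite scalerDr scalerA divff ?gt_eqF// scale1r addrAC -scalerDl subrKC scale1r.
  by rewrite subrKC.
have : fine (f (x + s^-1 *: (y - x))) <= M by rewrite -lee_fin dom_fineK.
move=> wM upper.
have : s * fine (f (x + s^-1 *: (y - x))) <= s * M by rewrite ler_pM2l.
by rewrite ler_norml; nra.
Unshelve. all: by end_near.
Qed.

End ConvexContinuity.

(** * The Bregman distance at interior points *)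

Section BregmanDistance.
Context {R : realType} {X : completeNormedModType R} {f : X -> \bar R}.
Context (f_proper : proper_function f) (f_strict : strictly_convex f).

Definition real_bregman y x : R :=
  fine (f y) - fine (f x) - gateaux f x (y - x).

Lemma bregmanE x y : gateaux_differentiable f x -> dom f y ->
  bregman f y x = (real_bregman y x)%:E.
Proof.
move=> df fy; have fx : dom f x by case: df => /interior_subset.
rewrite /bregman; case: asboolP => // _.
by rewrite -(dom_fineK f_proper fy) -(dom_fineK f_proper fx) -!EFinB.
Qed.

Lemma gateaux0 x : gateaux_differentiable f x -> gateaux f x 0 = 0.
Proof.
case=> _ _ L _; have := L (-1) 0 0.
by rewrite scaler0 addr0 /= scaleN1r addNr.
Qed.

Lemma gateauxZ x (s : R) u : gateaux_differentiable f x ->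
  gateaux f x (s *: u) = s * gateaux f x u.
Proof.
move=> df; case: (df) => _ _ L _; have := L s u 0.
by rewrite (gateaux0 df) !addr0.
Qed.

Lemma real_bregmanxx x : gateaux_differentiable f x -> real_bregman x x = 0.
Proof. by move=> df; rewrite /real_bregman !subrr gateaux0// subr0. Qed.

Lemma real_bregman_cvg x (u : nat -> X) : gateaux_differentiable f x ->
  lower_semicontinuous f -> forall w, u n @[n --> \oo] --> w -> (dom f)° w ->
  real_bregman (u n) x @[n --> \oo] --> real_bregman w x.
Proof.
move=> df f_lsc w uw w_int; apply: cvgB; [apply: cvgB|].
- have f_cvg := convex_lsc_continuous f_proper f_strict f_lsc w_int.
  exact: (cvg_comp _ _ uw f_cvg).
- exact: cvg_cst.
case: df => _ _ _ /(_ (w - x)) L_cvg.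
have ux : u n - x @[n --> \oo] --> w - x by apply: cvgB => //; exact: cvg_cst.
exact: (cvg_comp _ _ ux L_cvg).
Qed.

Lemma interior_algebraic (D : set X) x : D° x -> algebraic_interior D x.
Proof.
move=> /[dup] xD /nbhs_ballP[r /= r0 ball_D]; split.
  by apply: ball_D; exact: ballxx.
move=> y /eqP yx; have d0 : 0 < `|y - x| by rewrite normr_gt0 subr_eq0.
pose s := r / (r + `|y - x|).
have rd0 : 0 < r + `|y - x| by rewrite addr_gt0.
have s0 : 0 < s by rewrite divr_gt0.
have s1 : s < 1 by rewrite ltr_pdivrMr// mul1r ltrDl.
have sd : s * `|y - x| < r.
  by rewrite -mulrA gtr_pMr// mulrC ltr_pdivrMr// mul1r ltrDr.
exists ((1 - s) *: x + s *: y); first by exists s => //; rewrite /= s0.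
have segE (t : R) v : (1 - t) *: x + t *: v = x + t *: (v - x).
  by rewrite scalerBl scale1r scalerBr addrAC addrA.
move=> _ [t /andP[t0 t1] <-]; apply: ball_D.
rewrite !segE (addrC x (s *: _)) addrK -ball_normE/= opprD addrA subrr sub0r.
rewrite normrN normrZ normrZ (ger0_norm t0) (gtr0_norm s0).
by rewrite (le_lt_trans _ sd)// ler_piMl// mulr_ge0// ltW.
Qed.

(** A small displacement of [x + s *: (y - x)] is obtained by applying the same
displacement to [x] and [y], which stay in the domain. *)
Lemma interior_segment x y (s : R) : (dom f)° x -> (dom f)° y -> 0 <= s <= 1 ->
  (dom f)° (x + s *: (y - x)).
Proof.
move=> x_int y_int s01.
have shift (v : X) : (dom f)° v ->
    \forall w \near x + s *: (y - x), dom f (v + 1 *: (w - (x + s *: (y - x)))).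
  by move=> v_int; exact: (@cvg_dilation _ _ (x + s *: (y - x)) v 1 _ v_int).
rewrite /interior/=; near=> w.
have fx : dom f (x + 1 *: (w - (x + s *: (y - x)))) by near: w; exact: shift.
have fy : dom f (y + 1 *: (w - (x + s *: (y - x)))) by near: w; exact: shift.
have [+ _] := convex_fine f_proper f_strict fy fx s01.
have combE (v : X) : s *: (y + v) + (1 - s) *: (x + v) = x + s *: (y - x) + v.
  rewrite !scalerDr addrACA -scalerDl subrKC scale1r; congr (_ + v).
  by rewrite scalerBl scale1r scalerN addrCA.
by rewrite combE scale1r subrKC.
Unshelve. all: by end_near.
Qed.

(** The three-point identity
[D(y, x) = D(y, m) + D(m, x) + <y - m, f'(m) - f'(x)>], where collinearity
turns the last pairing into a multiple of
[<m - x, f'(m) - f'(x)> = D(m, x) + D(x, m)]. *)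
Lemma real_bregman_split x y m (k : R) : gateaux_differentiable f x ->
  gateaux_differentiable f m -> y - x = k *: (m - x) ->
  real_bregman y x = real_bregman y m + real_bregman m x +
    (k - 1) * (real_bregman m x + real_bregman x m).
Proof.
move=> dx dm yx; have ym : y - m = (k - 1) *: (m - x).
  by rewrite scalerBl scale1r -yx opprB addrA subrK.
have xm : x - m = (-1) *: (m - x) by rewrite scaleN1r opprB.
by rewrite /real_bregman yx ym xm !gateauxZ//; ring.
Qed.

Context (f_diff : forall x, (dom f)° x -> gateaux_differentiable f x).
Context (f_total : totally_convex f).

(** The base point of the modulus is the first argument of the distance, so
total convexity at [y] is what controls [D(y, x)]. *)
Lemma modulus_le_real_bregman x y : (dom f)° x -> (dom f)° y ->
  (total_convexity_modulus f y `|x - y|%R <= (real_bregman y x)%:E)%E.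
Proof.
move=> x_int y_int; rewrite -bregmanE//; last 2 first.
- exact: f_diff.
- exact: interior_subset.
apply: ereal_inf_lbound; exists x => //; split=> //.
exact: interior_subset.
Qed.

Lemma real_bregman_gt0 x y : (dom f)° x -> (dom f)° y -> x != y ->
  0 < real_bregman y x.
Proof.
move=> x_int y_int xy; rewrite -lte_fin.
apply: lt_le_trans (modulus_le_real_bregman x_int y_int).
by apply: f_total; [exact: interior_algebraic|rewrite normr_gt0 subr_eq0].
Qed.

Lemma real_bregman_ge0 x y : (dom f)° x -> (dom f)° y -> 0 <= real_bregman y x.
Proof.
move=> x_int y_int; have [<-|xy] := eqVneq x y.
  by rewrite real_bregmanxx//; exact: f_diff.
exact/ltW/real_bregman_gt0.
Qed.

(** The constant comes from the modulus at [x] and [t / 2]: the point [m] at distance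
[t / 2] from [x] towards [y] lies in the nearer half of the segment, so that
[real_bregman_split] applies with a factor [k >= 2] and all its terms are
nonnegative, whence [D(y, x) >= D(x, m)]. *)
Lemma real_bregman_ge_far x (t : R) : (dom f)° x -> 0 < t ->
  exists2 c, 0 < c &
    forall y, (dom f)° y -> t <= `|y - x| -> c <= real_bregman y x.
Proof.
move=> x_int t0.
have [c c0 c_le] : exists2 c : R, 0 < c &
    (c%:E <= total_convexity_modulus f x (t / 2))%E.
  have : (0 < total_convexity_modulus f x (t / 2))%E.
    by apply: f_total; [exact: interior_algebraic|rewrite divr_gt0].
  case: (total_convexity_modulus f x _) => [c|_|//]; last by exists 1; rewrite ?leey.
  by rewrite lte_fin => c0; exists c.
exists c => // y y_int ty.
have d0 : 0 < `|y - x| by exact: lt_le_trans ty.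
pose s := t / 2 / `|y - x|.
have s0 : 0 < s by rewrite !divr_gt0.
have s2 : 2 <= s^-1 by rewrite invf_div ler_pdivlMr ?divr_gt0//; lra.
have s01 : 0 <= s <= 1.
  by rewrite ltW//= -[leRHS]invr1 -[leLHS]invrK lef_pV2 ?posrE ?invr_gt0//; lra.
pose m := x + s *: (y - x).
have m_int : (dom f)° m by exact: interior_segment.
have mx : m - x = s *: (y - x) by rewrite /m addrC addKr.
have mx_norm : `|m - x| = t / 2.
  by rewrite mx normrZ gtr0_norm// divfK// gt_eqF.
have yx : y - x = s^-1 *: (m - x) by rewrite mx scalerA mulVf ?scale1r ?gt_eqF.
have c_m : c <= real_bregman x m.
  rewrite -lee_fin (le_trans c_le)// -mx_norm.
  exact: modulus_le_real_bregman.
rewrite (real_bregman_split (f_diff x_int) (f_diff m_int) yx).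
have ym0 := real_bregman_ge0 m_int y_int.
have mx0 := real_bregman_ge0 x_int m_int.
have : 1 * (real_bregman m x + real_bregman x m) <=
    (s^-1 - 1) * (real_bregman m x + real_bregman x m).
  by apply: ler_wpM2r; lra.
lra.
Qed.

Lemma cvg_real_bregman0 x (u : nat -> X) : (dom f)° x ->
  (forall n, (dom f)° (u n)) ->
  real_bregman (u n) x @[n --> \oo] --> (0 : R) -> u n @[n --> \oo] --> x.
Proof.
move=> x_int u_int u0; apply/cvgrPdist_lt => e e0.
have [c c0 c_le] := real_bregman_ge_far x_int e0.
near=> n; rewrite distrC ltNge; apply/negP => /(c_le _ (u_int n)).
apply/negP; rewrite -ltNge.
near: n; exact: (cvgr_lt _ u0).
Unshelve. all: by end_near.
Qed.

End BregmanDistance.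
Arguments real_bregman {R X} f y x.

(** * Geometric decay along a period *)

Lemma geometric_decay {R : realType} (b : nat -> R) (c : R) (p : nat) :
  (0 < p)%N -> 0 <= c < 1 -> (forall n, 0 <= b n) ->
  (forall n, b (n + p)%N <= c * b n) -> b n @[n --> \oo] --> (0 : R).
Proof.
move=> p0 /andP[c0 c1] b0 b_le.
have b_pow q r : b (q * p + r)%N <= c ^+ q * b r.
  elim: q => [|q IHq]; first by rewrite mul1r.
  rewrite mulSn -addnA addnC (le_trans (b_le _))// exprS -mulrA.
  exact: ler_wpM2l.
pose M := \sum_(r < p) b r.
have b_M n : b n <= c ^+ (n %/ p) * M.
  rewrite {1}(divn_eq n p) (le_trans (b_pow _ _))// ler_wpM2l ?exprn_ge0//.
  rewrite /M (bigD1 (Ordinal (ltn_pmod n p0)))//= lerDl.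
  exact: sumr_ge0.
have pow_cvg : c ^+ (n %/ p) * M @[n --> \oo] --> (0 : R).
  rewrite -(mul0r M); apply: cvgMr_tmp.
  have c_cvg : (c ^+ n) @[n --> \oo] --> (0 : R) by apply: cvg_expr; rewrite ger0_norm.
  exact: (cvg_comp _ _ (@cvg_divnr p p0) c_cvg).
apply: (squeeze_cvgr _ (cvg_cst 0) pow_cvg).
by near=> n; rewrite b0 b_M.
Unshelve. all: by end_near.
Qed.

(** * Orbits of hybrid cyclic maps *)

Section HybridCyclicMap.
Context {R : realType} {X : completeNormedModType R} {p : nat}.
Context {f : X -> \bar R} {A : 'I_p -> set X} {T : X -> X}.
Context {K lam : X -> R} {Ki : 'I_p -> X -> R} {a : 'I_p -> R}.
Context (f_proper : proper_function f) (f_strict : strictly_convex f).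
Context (f_diff : forall x, (dom f)° x -> gateaux_differentiable f x).
Context (f_total : totally_convex f) (f_lsc : lower_semicontinuous f).
Context (A_int : forall i, A i `<=` (dom f)°).
Context (T_hybrid : hybrid_cyclic f A T K lam Ki a).

Lemma orbit_mem i x n : A i x -> A (iter n (@ordS p) i) (iter n T x).
Proof.
move=> Ax; elim: n => [//|n IHn] /=.
exact: (hybrid_cyclic_map T_hybrid).
Qed.

Lemma meet_image z : (\bigcap_i A i) z -> (\bigcap_i A i) (T z).
Proof.
move=> zA i _; rewrite -(ord_predK i).
exact: (hybrid_cyclic_map T_hybrid (zA (ord_pred i) I)).
Qed.

Lemma hybrid_real i x y : A i x -> A (ordS i) y ->
  real_bregman f (T x) (T y) <=
    Ki i y * real_bregman f x y + lam y * gateaux_gap f T y (x - T x).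
Proof.
move=> Ax Ay; have Tx := hybrid_cyclic_map T_hybrid Ax.
have Ty := hybrid_cyclic_map T_hybrid Ay.
have A_dom j u : A j u -> dom f u by move=> /A_int /interior_subset.
have := hybrid_ineq T_hybrid Ax Ay.
rewrite (bregmanE f_proper (f_diff (A_int Ty)) (A_dom _ _ Tx)).
rewrite (bregmanE f_proper (f_diff (A_int Ay)) (A_dom _ _ Ax)).
by rewrite -EFinM -EFinD lee_fin.
Qed.

(** If [T z] differed from [z], then [D(z, Tz) > 0]; but the hybrid inequality
between [T^n x] and [z] tends to [D(z, Tz) <= 0]. *)
Lemma limit_fixed i x z : A i x -> (\bigcap_i A i) z ->
  iter n T x @[n --> \oo] --> z -> T z = z.
Proof.
move=> Ax zA x_z.
have z_int := A_int (zA i I).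
have Tz_int := A_int (meet_image zA (i := i) I).
have x_int n := A_int (orbit_mem n Ax).
apply/eqP/negP => /negP Tz_neq.
have := real_bregman_gt0 f_proper f_diff f_total Tz_int z_int Tz_neq.
apply/negP; rewrite -leNgt.
(* The index of the set containing [T^n x] varies with [n], hence a bound on the
   factors uniform in the index. *)
pose M := \sum_i a i.
pose b n := real_bregman f (iter n T x) z.
pose c n := M * b n + lam z * gateaux_gap f T z (iter n T x - iter n.+1 T x).
have step n : real_bregman f (iter n.+1 T x) (T z) <= c n.
  have := hybrid_real (orbit_mem n Ax) (zA (ordS (iter n (@ordS p) i)) I).
  move=> /le_trans; apply; rewrite lerD2r; apply: ler_wpM2r.
    exact: real_bregman_ge0.
  have /andP[_ /le_trans] := hybrid_factor T_hybrid (zA (ordS (iter n (@ordS p) i)) I).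
  apply; rewrite /M (bigD1 (iter n (@ordS p) i))//= lerDl sumr_ge0// => j _.
  exact: ltW (hybrid_bound_gt0 T_hybrid j).
have x_z1 : iter n.+1 T x @[n --> \oo] --> z.
  by rewrite (cvg_shiftS (fun n => iter n T x)).
have lhs_cvg : real_bregman f (iter n.+1 T x) (T z) @[n --> \oo] -->
    real_bregman f z (T z).
  exact: (real_bregman_cvg f_proper f_strict (f_diff Tz_int) f_lsc x_z1 z_int).
have b_cvg : b n @[n --> \oo] --> (0 : R).
  rewrite -(real_bregmanxx (f_diff z_int)).
  exact: (real_bregman_cvg f_proper f_strict (f_diff z_int) f_lsc x_z z_int).
have diff_cvg : iter n T x - iter n.+1 T x @[n --> \oo] --> (0 : X).
  by rewrite -(subrr z); exact: cvgB.
have gateaux_cvg y : gateaux_differentiable f y ->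
    gateaux f y (iter n T x - iter n.+1 T x) @[n --> \oo] --> (0 : R).
  move=> dy; rewrite -(gateaux0 dy).
  by case: dy => _ _ _ /(_ 0) L_cvg; exact: (cvg_comp _ _ diff_cvg L_cvg).
have c_cvg : c n @[n --> \oo] --> (0 : R).
  have -> : (0 : R) = M * 0 + lam z * (0 - 0) by rewrite subr0 !mulr0 addr0.
  apply: cvgD; first by apply: cvgMl_tmp.
  by apply: cvgMl_tmp; apply: cvgB; apply: gateaux_cvg; exact: f_diff.
apply: (ler_cvg_to lhs_cvg c_cvg); exact: nearW.
Qed.

(** At a fixed point [y = z] the gradient term vanishes, so each step only
multiplies the distance to [z] by the current factor. *)
Lemma real_bregman_orbit i x z n : A i x -> (\bigcap_i A i) z -> T z = z ->
  real_bregman f (iter n T x) z <=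
    (\prod_(k < n) Ki (iter k (@ordS p) i) z) * real_bregman f x z.
Proof.
move=> Ax zA Tz; elim: n => [|n IHn]; first by rewrite big_ord0 mul1r.
have := hybrid_real (orbit_mem n Ax) (zA (ordS (iter n (@ordS p) i)) I).
rewrite /gateaux_gap Tz subrr mulr0 addr0 => /le_trans; apply.
rewrite big_ord_recr/= mulrAC [leRHS]mulrC; apply: ler_wpM2l => //.
by have /andP[/ltW] := hybrid_factor T_hybrid (zA (ordS (iter n (@ordS p) i)) I).
Qed.

(** Wherever the orbit stands in the cycle, the [p] factors of the next turn
multiply to [K z < 1], as [z] lies in every [A i]. *)
Lemma orbit_cvg i x z : A i x -> (\bigcap_i A i) z -> T z = z ->
  iter n T x @[n --> \oo] --> z.
Proof.
move=> Ax zA Tz.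
have z_int := A_int (zA i I).
have x_int n := A_int (orbit_mem n Ax).
apply: (cvg_real_bregman0 f_proper f_strict f_diff f_total z_int x_int).
have /andP[K0 K1] : 0 < K z < 1.
  by apply: (hybrid_modulus T_hybrid); exists i => //; exact: zA i I.
apply: (@geometric_decay _ _ (K z) p).
- exact: leq_ltn_trans (ltn_ord i).
- by rewrite ltW.
- by move=> n; exact: real_bregman_ge0.
move=> n; rewrite addnC iterD.
have := real_bregman_orbit p (orbit_mem n Ax) zA Tz.
have -> // : \prod_(k < p) Ki (iter k (@ordS p) (iter n (@ordS p) i)) z = K z.
rewrite (hybrid_product T_hybrid (zA (ordS (iter n (@ordS p) i)) I)).
by apply: eq_bigr => k _; congr (Ki _ _); elim: (val k) => //= j <-.
Qed.

End HybridCyclicMap.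

Theorem theorem2p3 (R : realType) (X : completeNormedModType R)
  (H : set X) (ip : X -> X -> R) (hH : hilbert_subspace H ip)
  (p : nat) (hp : (2 <= p)%N)
  (f : X -> \bar R)
  (f_lsc : lower_semicontinuous f)
  (f_proper : proper_function f)
  (D_convex : convex_set (dom f))
  (f_strict : strictly_convex f)
  (f_total : totally_convex f)
  (f_diff : forall x, (dom f)° x -> gateaux_differentiable f x)
  (A : 'I_p -> set X) (T : X -> X)
  (A_neq0 : forall i, A i !=set0)
  (A_int : forall i, A i `<=` (dom f)°)
  (D_H : (dom f)° `<=` H)
  (A_bounded : forall i, bounded_set (A i))
  (A_closed : forall i, closed (A i))
  (A_convex : forall i, convex_set (A i))
  (A_meet : \bigcap_i A i !=set0)
  (Lam : set R) (Lam_bounded : bounded_set (Lam : set R^o))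
  (lam : X -> R) (lam_Lam : set_fun (\bigcup_i A i) Lam lam)
  (K : X -> R) (Ki : 'I_p -> X -> R) (a : 'I_p -> R)
  (T_hybrid : hybrid_cyclic f A T K lam Ki a)
  (x0 z : X) (x0_A : (\bigcup_i A i) x0) (z_A : (\bigcap_i A i) z)
  (x0_z : iter n T x0 @[n --> \oo] --> z) :
  [/\ T z = z,
      forall w, (\bigcup_i A i) w -> T w = w -> w = z &
      forall x, (\bigcup_i A i) x -> iter n T x @[n --> \oo] --> z].

Proof.
case: x0_A => i _ Ax0.
have Tz := limit_fixed f_proper f_strict f_diff f_total f_lsc A_int T_hybrid
  Ax0 z_A x0_z.
have cvg_z x : (\bigcup_i A i) x -> iter n T x @[n --> \oo] --> z.
  case=> j _ Ax.
  exact: (orbit_cvg f_proper f_strict f_diff f_total A_int T_hybrid Ax z_A Tz).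
split=> // w /cvg_z w_z Tw; apply: (cvg_unique _ _ w_z) => //.
have -> : (fun n => iter n T w) = cst w.
  by apply/funext => n; elim: n => //= n ->.
exact: cvg_cst.
Qed.
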